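(* Let $p\in\{2,3,4,5\}$, $\eta\ge0$, $N\in\mathbb N$, $h=1/N$, $\omega_j=j\pi$, $\lambda_j=\omega_j^2$, and let $\hat\lambda^h_j=(\omega^h_j)^2$ be the $j$-th eigenvalue of $p$-th order softIGA with $N$ uniform elements on $[0,1]$ (see context), where $1\le j\le N$ if $p$ is even and $1\le j\le N-1$ if $p$ is odd. Then, as $\omega_jh\to0$, $$\frac{(\omega^h_j)^2-\omega_j^2}{\omega_j^2}=\begin{cases}\big(\frac1{720}-\eta\big)(\omega_jh)^4+\frac{(\omega_jh)^6}{3360}+\mathcal O((\omega_jh)^8),&p=2,\\[2pt] \big(\frac1{30240}-\eta\big)(\omega_jh)^6+\frac{(\omega_jh)^8}{60480}+\mathcal O((\omega_jh)^{10}),&p=3,\\[2pt] \big(\frac1{1209600}-\eta\big)(\omega_jh)^8+\frac{(\omega_jh)^{10}}{1368576}+\mathcal O((\omega_jh)^{12}),&p=4,\\[2pt] \big(\frac1{47900160}-\eta\big)(\omega_jh)^{10}+\frac{691(\omega_jh)^{12}}{24216192000}+\mathcal O((\omega_jh)^{14}),&p=5.\end{cases}$$ Consequently, for each fixed $j$ there is a constant $C>0$ independent of $h$ such that $\frac{|\hat\lambda^h_j-\lambda_j|}{\lambda_j}\le Ch^{2p}$; and if $\eta=\frac1{720},\frac1{30240},\frac1{1209600},\frac1{47900160}$ for $p=2,3,4,5$ respectively, then for each fixed $j$ there is a constant $C>0$ independent of $h$ such that $\frac{|\hat\lambda^h_j-\lambda_j|}{\lambda_j}\le Ch^{2p+2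}$.
   Context: $p$-th order softIGA for $-u''=\lambda u$ on $[0,1]$, $u(0)=u(1)=0$, with $N$ uniform elements is the generalized matrix eigenvalue problem $(\tilde K_p-\eta S_p)\hat U=\hat\lambda^h\tilde M_p\hat U$. All matrices are Toeplitz-plus-Hankel: for even $p$ they are $N\times N$ with $A_{kl}=\sum_{m\in\mathbb Z}(a_{|k-l+2Nm|}-a_{|k+l-1+2Nm|})$, and for odd $p$ they are $(N-1)\times(N-1)$ with $A_{kl}=\sum_{m\in\mathbb Z}(a_{|k-l+2Nm|}-a_{|k+l+2Nm|})$. The stencils $(a_0,a_1,\dots)$ (entries not listed are $0$) are: $h\tilde K_2$: $(1,-\frac13,-\frac16)$; $h^{-1}\tilde M_2$: $(\frac{11}{20},\frac{13}{60},\frac1{120})$; $hS_2$: $(20,-15,6,-1)$. $h\tilde K_3$: $(\frac23,-\frac18,-\frac15,-\frac1{120})$; $h^{-1}\tilde M_3$: $(\frac{151}{315},\frac{397}{1680},\frac1{42},\frac1{5040})$; $hS_3$: $(70,-56,28,-8,1)$. $h\tilde K_4$: $(\frac{35}{72},-\frac{11}{360},-\frac{17}{90},-\frac{59}{2520},-\frac1{5040})$; $h^{-1}\tilde M_4$: $(\frac{15619}{36288},\frac{44117}{181440},\frac{913}{22680},\frac{251}{181440},\frac1{362880})$; $hS_4$: $(252,-210,120,-45,10,-1)$. $h\tilde K_5$: $(\frac{809}{2160},\frac1{64},-\frac{31}{189},-\frac{907}{24192},-\frac{25}{18144},-\frac1{362880})$; $h^{-1}\tilde M_5$: $(\frac{655177}{1663200},\frac{1623019}{6652800},\frac{1093}{19800},\frac{50879}{13305600},\frac{509}{9979200},\frac1{39916800})$;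 $hS_5$: $(924,-792,495,-220,66,-12,1)$. The $j$-th eigenvalue $\hat\lambda^h_j$ is the one whose eigenvector is the Bloch wave $\big(\sin(\omega_j(k-\frac12)h)\big)_{k=1}^N$ (even $p$) or $\big(\sin(\omega_jkh)\big)_{k=1}^{N-1}$ (odd $p$). The notation $(\omega^h_j)^2$ simply stands for $\hat\lambda^h_j$. The implied constants in $\mathcal O(\cdot)$ depend only on $p$ and $\eta$. *)

(* Defs.v *)
From HB Require Import structures.
From mathcomp Require Import all_boot all_order all_algebra.
From mathcomp Require Import boolp classical_sets fsbigop reals trigo.

Set Implicit Arguments.
Unset Strict Implicit.
Unset Printing Implicit Defensive.

Import Order.TTheory GRing.Theory Num.Theory.

Local Open Scope ring_scope.
Local Open Scope classical_set_scope.

(* Numerals are written n%:R so that the large ones stay in decimal form      *)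
(* (Nat.of_num_uint); a bare numeral of ring_scope is expanded in unary.      *)

(* A stencil is the list of its possibly nonzero entries: the entry of index  *)
(* i is a`_i, which is 0 beyond the end of the list. The three stencils below *)
(* are those of h K, h^-1 M and h S.                                          *)

Definition stencilK (R : realType) (p : nat) : seq R :=
  match p with
  | 2 => [:: 1; - (1 / 3%:R); - (1 / 6%:R)]
  | 3 => [:: 2%:R / 3%:R; - (1 / 8%:R); - (1 / 5%:R); - (1 / 120%:R)]
  | 4 => [:: 35%:R / 72%:R; - (11%:R / 360%:R); - (17%:R / 90%:R);
             - (59%:R / 2520%:R); - (1 / 5040%:R)]
  | 5 => [:: 809%:R / 2160%:R; 1 / 64%:R; - (31%:R / 189%:R);
             - (907%:R / 24192%:R); - (25%:R / 18144%:R); - (1 / 362880%:R)]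
  | _ => [::]
  end.

Definition stencilM (R : realType) (p : nat) : seq R :=
  match p with
  | 2 => [:: 11%:R / 20%:R; 13%:R / 60%:R; 1 / 120%:R]
  | 3 => [:: 151%:R / 315%:R; 397%:R / 1680%:R; 1 / 42%:R; 1 / 5040%:R]
  | 4 => [:: 15619%:R / 36288%:R; 44117%:R / 181440%:R; 913%:R / 22680%:R;
             251%:R / 181440%:R; 1 / 362880%:R]
  | 5 => [:: 655177%:R / 1663200%:R; 1623019%:R / 6652800%:R;
             1093%:R / 19800%:R; 50879%:R / 13305600%:R;
             509%:R / 9979200%:R; 1 / 39916800%:R]
  | _ => [::]
  end.

Definition stencilS (R : realType) (p : nat) : seq R :=
  match p with
  | 2 => [:: 20%:R; - 15%:R; 6%:R; - 1]
  | 3 => [:: 70%:R; - 56%:R; 28%:R; - 8%:R; 1]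
  | 4 => [:: 252%:R; - 210%:R; 120%:R; - 45%:R; 10%:R; - 1]
  | 5 => [:: 924%:R; - 792%:R; 495%:R; - 220%:R; 66%:R; - 12%:R; 1]
  | _ => [::]
  end.

Definition ndof (p N : nat) : nat := if odd p then N.-1 else N.

(* Row i and column j of MathComp are k = i + 1 and l = j + 1. The sum over   *)
(* all m : int has finite support because the stencil is finite; its last     *)
(* index is k + l for odd p and k + l - 1 for even p.                         *)
Definition toeplitz_hankel (R : realType) (p N : nat) (a : seq R) :
    'M[R]_(ndof p N) :=
  \matrix_(i, j)
    let k : int := i.+1%:Z in
    let l : int := j.+1%:Z in
    let s : int := if odd p then k + l else k + l - 1 in
    \sum_(m \in [set: int])
      (a`_(absz (k - l + 2%:Z * N%:Z * m)) - a`_(absz (s + 2%:Z * N%:Z * m))).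

Definition meshsize (R : realType) (N : nat) : R := N%:R^-1.

Definition stiffness (R : realType) (p N : nat) : 'M[R]_(ndof p N) :=
  (meshsize R N)^-1 *: toeplitz_hankel p N (stencilK R p).

Definition mass (R : realType) (p N : nat) : 'M[R]_(ndof p N) :=
  meshsize R N *: toeplitz_hankel p N (stencilM R p).

Definition softness (R : realType) (p N : nat) : 'M[R]_(ndof p N) :=
  (meshsize R N)^-1 *: toeplitz_hankel p N (stencilS R p).

Definition omega (R : realType) (j : nat) : R := j%:R * pi.

Definition bloch (R : realType) (p N j : nat) : 'cV[R]_(ndof p N) :=
  \col_i
    let k : R := i.+1%:R in
    if odd p then sin (omega R j * k * meshsize R N)
    else sin (omega R j * (k - 1 / 2%:R) * meshsize R N).

Definition gen_eigenpair (R : realType) (n : nat) (A B : 'M[R]_n)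
    (lam : R) (U : 'cV[R]_n) : Prop :=
  U != 0 /\ A *m U = lam *: (B *m U).

(* The eigenvalue whose eigenvector is the j-th Bloch wave; xget returns its  *)
(* default value 0 only if that wave is not an eigenvector.                   *)
Definition softIGA_eigenvalue (R : realType) (p : nat) (eta : R) (N j : nat) :
    R :=
  xget 0 [set lam | gen_eigenpair (stiffness R p N - eta *: softness R p N)
                      (mass R p N) lam (bloch R p N j)].

Definition lambda_exact (R : realType) (j : nat) : R := omega R j ^+ 2.

Definition rel_error (R : realType) (p : nat) (eta : R) (N j : nat) : R :=
  (softIGA_eigenvalue p eta N j - lambda_exact R j) / lambda_exact R j.

Definition mode_index (p N j : nat) : bool := (1 <= j <= ndof p N)%N.

(* The leading error coefficient is error_coef p - eta, so that               *)
(* eta = error_coef p cancels it.                                             *)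
Definition error_coef (R : realType) (p : nat) : R :=
  match p with
  | 2 => 1 / 720%:R
  | 3 => 1 / 30240%:R
  | 4 => 1 / 1209600%:R
  | 5 => 1 / 47900160%:R
  | _ => 0
  end.

Definition error_coef_next (R : realType) (p : nat) : R :=
  match p with
  | 2 => 1 / 3360%:R
  | 3 => 1 / 60480%:R
  | 4 => 1 / 1368576%:R
  | 5 => 691%:R / 24216192000%:R
  | _ => 0
  end.

(* Main.v *)
Require Import Defs.
From HB Require Import structures.
From mathcomp Require Import all_boot all_order all_algebra.
From mathcomp Require Import boolp classical_sets fsbigop reals trigo.
From mathcomp Require Import topology normedtype sequences ring lra zify.

Set Implicit Arguments.
Unset Strict Implicit.
Unset Printing Implicit Defensive.

Import Order.TTheory GRing.Theory Num.Theory numFieldNormedType.Exports.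

Local Open Scope ring_scope.

(** Extended antisymmetrically and periodically to all integers, the Bloch wave
    turns every Toeplitz-plus-Hankel matrix into a convolution, so it is an
    eigenvector whose eigenvalue is the symbol
    [a_0 + 2 \sum_(q >= 1) a_q cos (q t)] of the stencil at [t = omega_j h].
    Hence [lambda h^2 = (K(t) - eta S(t)) / M(t)]. The Taylor coefficients of
    the symbols are moments of the stencils, and the expansion reduces to
    finitely many rational identities between them: [K] and [t^2 M] agree up to
    order [t^(2p)], the next two differences produce the error coefficients, and
    [S = t^(2p+2) (1 + m_1 t^2) + O(t^(2p+6))] with [m_1] the second-order
    coefficient of [M], so that [eta] does not enter the second error term. *)

(** * Symbols and moments of stencils *)

(* Locked, so that unification never unfolds a stencil and its numerals. *)
HB.lock Definition weighted_sum (R : realType) (k : nat) (a : seq R)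
    (F : nat -> R) : R :=
  \sum_(q < size a) a`_q * F (k + q)%N.

Lemma weighted_sum_nil (R : realType) k (F : nat -> R) :
  weighted_sum k [::] F = 0.
Proof. by rewrite unlock big_ord0. Qed.

Lemma weighted_sum_cons (R : realType) k x (a : seq R) (F : nat -> R) :
  weighted_sum k (x :: a) F = x * F k + weighted_sum k.+1 a F.
Proof.
rewrite unlock /= big_ord_recl /= addn0; congr (_ + _).
by apply: eq_bigr => i _; rewrite addSnnS.
Qed.

(** The number of integers of absolute value [q]: stencil entries are indexed by [|z|], while
    convolution runs over both signs of [z]. *)
Definition multiplicity (R : realType) (q : nat) : R :=
  if q is 0%N then 1 else 2%:R.

Definition symbol (R : realType) (a : seq R) (t : R) : R :=
  weighted_sum 0 a (fun q => multiplicity R q * cos (q%:R * t)).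

(** The coefficient of [t^(2i)] in the Taylor series of the symbol, as [cos_coeff' 1 i] is
    [(-1)^i / (2i)!]. *)
Definition moment (R : realType) (a : seq R) (i : nat) : R :=
  cos_coeff' 1 i *
  weighted_sum 0 a (fun q => multiplicity R q * q%:R ^+ i.*2).

(** * Taylor remainders of the cosine and of symbols *)

Lemma cos_coeff'S (R : realType) (x : R) i :
  cos_coeff' x i.+1 = - (x ^+ 2 / (i.*2.+1%:R * i.*2.+2%:R)) * cos_coeff' x i.
Proof.
rewrite /cos_coeff' !factS !natrM doubleS -[_ ^ i.+1]/((-1) ^+ i.+1).
rewrite -[_ ^ i]/((-1) ^+ i) !exprS.
have : i.*2`!%:R != 0 :> R by rewrite pnatr_eq0 -lt0n fact_gt0.
have : (0 : R) <= i.*2%:R by exact: ler0n.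
rewrite -!natr1.
move: (i.*2`!%:R) (i.*2%:R) => f u u0 f0.
by field; rewrite f0 ?andbT /=; apply/andP; split; rewrite gt_eqF //; lra.
Qed.

Lemma cos_coeff'0 (R : realType) (x : R) : cos_coeff' x 0 = 1.
Proof. by rewrite /cos_coeff' fact0 divr1 mulr1. Qed.

Lemma cos_coeff'Ml (R : realType) (x t : R) i :
  cos_coeff' (x * t) i = cos_coeff' 1 i * x ^+ i.*2 * t ^+ i.*2.
Proof. by rewrite /cos_coeff' expr1n exprMn; ring. Qed.

Lemma normr_cos_coeff'_half (R : realType) (x : R) i : `|x| <= 1 ->
  `|cos_coeff' x i.+1| * 2%:R <= `|cos_coeff' x i|.
Proof.
move=> x1; rewrite cos_coeff'S mulNr normrN normrM mulrAC.
rewrite ler_piMl ?normr_ge0 // ger0_norm; last first.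
  by rewrite divr_ge0 ?sqr_ge0 // mulr_ge0.
rewrite mulrAC ler_pdivrMr ?mul1r; last by rewrite mulr_gt0 // ltr0n.
have h2 : x ^+ 2 <= 1 by rewrite -[x ^+ 2]ger0_norm ?sqr_ge0 // normrX expr_le1.
have : (1 : R) <= i.*2.+1%:R by rewrite ler1n.
have : (2%:R : R) <= i.*2.+2%:R by rewrite ler_nat.
nra.
Qed.

Lemma normr_cos_coeff' (R : realType) (x : R) i :
  `|cos_coeff' x i| <= x ^+ i.*2.
Proof.
rewrite /cos_coeff' -[_ ^ i]/((-1) ^+ i) -mulrA normrMsign normrM.
have x0 : 0 <= x ^+ i.*2 by rewrite -mul2n exprM exprn_ge0 // sqr_ge0.
rewrite (ger0_norm x0) ler_piMr // ger0_norm ?invr_ge0 //.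
by rewrite invf_le1 ?ler1n ?ltr0n ?fact_gt0.
Qed.

(** For [|x| <= 1] consecutive terms shrink at least by half, so the tail is dominated by a
    geometric series: at most twice the first omitted term. *)
Lemma cos_taylor (R : realType) (x : R) n : `|x| <= 1 ->
  `|cos x - \sum_(i < n) cos_coeff' x i| <= 2%:R * x ^+ n.*2.
Proof.
move=> x1.
(* The left-hand side does not increase with [m]: half of the doubled last term pays for adding it
   to the partial sum, the other half for the next doubled term. *)
have tail m : `|series (cos_coeff' x) (n + m)%N - \sum_(i < n) cos_coeff' x i| +
    2%:R * `|cos_coeff' x (n + m)| <= 2%:R * x ^+ n.*2.
  elim: m => [|m IHm].
    rewrite addn0 (_ : series _ n = \sum_(i < n) cos_coeff' x i); last first.
      by rewrite /series /= big_mkord.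
    rewrite addrN normr0 add0r.
    by rewrite ler_pM2l // normr_cos_coeff'.
  apply: le_trans IHm; rewrite addnS seriesSr addrAC.
  have := normr_cos_coeff'_half (n + m) x1.
  have := ler_normD (series (cos_coeff' x) (n + m)%N -
    \sum_(i < n) cos_coeff' x i) (cos_coeff' x (n + m)).
  by lra.
set S := \sum_(i < n) _.
have h : (`|series (cos_coeff' x) N - S| @[N --> \oo] --> `|cos x - S|)%classic.
  by apply: cvg_norm; apply: cvgB; [exact: cvg_cos_coeff' | exact: cvg_cst].
rewrite -(cvg_lim (@Rhausdorff R) h).
apply: limr_le; first by apply/cvg_ex; exists `|cos x - S|; exact: h.
near=> N.
have nN : (n <= N)%N by near: N; exact: nbhs_infty_ge.
have := tail (N - n)%N; rewrite subnKC //.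
have := normr_ge0 (cos_coeff' x N); rewrite /=; lra.
Unshelve. all: by end_near.
Qed.

(** The condition on [t] puts every argument [q t] with [q < size a] in [[0, 1]], where [cos_taylor]
    applies entry by entry. *)
Lemma symbol_taylor (R : realType) (a : seq R) n : exists2 C : R, 0 <= C &
  forall t : R, 0 <= t -> t * (size a)%:R <= 1 ->
  `|symbol a t - \sum_(i < n) moment a i * t ^+ i.*2| <= C * t ^+ n.*2.
Proof.
exists (\sum_(q < size a) `|a`_q * multiplicity R q| * (2%:R * q%:R ^+ n.*2)).
  by apply: sumr_ge0 => q _; rewrite !mulr_ge0 // exprn_ge0.
move=> t t0 ta.
have -> : \sum_(i < n) moment a i * t ^+ i.*2 =
    \sum_(q < size a) a`_q * multiplicity R q *
      \sum_(i < n) cos_coeff' (q%:R * t) i.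
  rewrite /moment weighted_sum.unlock.
  under eq_bigr => i _ do rewrite mulr_sumr mulr_suml.
  rewrite exchange_big /=; apply: eq_bigr => q _; rewrite mulr_sumr.
  by apply: eq_bigr => i _; rewrite cos_coeff'Ml; ring.
rewrite /symbol weighted_sum.unlock -sumrB mulr_suml.
apply: le_trans (ler_norm_sum _ _ _) _; apply: ler_sum => q _.
rewrite mulrA -mulrBr normrM -mulrA ler_wpM2l //.
have qt : `|q%:R * t| <= 1.
  rewrite ger0_norm ?mulr_ge0 //; apply: le_trans ta.
  rewrite mulrC ler_wpM2l //.
  by rewrite ler_nat ltnW.
by apply: le_trans (cos_taylor n qt) _; rewrite exprMn mulrA.
Qed.

(** * Rational moment identities of the stencils *)

Lemma cos_coeff'1 (R : realType) :
  let f := cos_coeff' (1 : R) in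
  (f 0%N = 1) * (f 1%N = - (1 / 2%:R)) * (f 2%N = 1 / 24%:R) *
  (f 3%N = - (1 / 720%:R)) * (f 4%N = 1 / 40320%:R) *
  (f 5%N = - (1 / 3628800%:R)) * (f 6%N = 1 / 479001600%:R) *
  (f 7%N = - (1 / 87178291200%:R)).
Proof.
move=> f.
have fS i : f i.+1 = - (1 / (i.*2.+1%:R * i.*2.+2%:R)) * f i.
  by rewrite /f cos_coeff'S expr1n.
have h0 : f 0%N = 1 by exact: cos_coeff'0.
move: f fS h0 => f fS h0.
have h1 : f 1%N = - (1 / 2%:R) by rewrite fS h0 double0; field.
have h2 : f 2%N = 1 / 24%:R by rewrite fS h1 !doubleS double0; field.
have h3 : f 3%N = - (1 / 720%:R) by rewrite fS h2 !doubleS double0; field.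
have h4 : f 4%N = 1 / 40320%:R by rewrite fS h3 !doubleS double0; field.
have h5 : f 5%N = - (1 / 3628800%:R) by rewrite fS h4 !doubleS double0; field.
have h6 : f 6%N = 1 / 479001600%:R by rewrite fS h5 !doubleS double0; field.
(* The last order needed: moments occur up to index [p + 2 <= 7]. *)
have h7 : f 7%N = - (1 / 87178291200%:R)
  by rewrite fS h6 !doubleS double0; field.
exact: (h0, h1, h2, h3, h4, h5, h6, h7).
Qed.

(* The large numerals must never be reduced: [cos_coeff' 1] is generalized    *)
(* before any rewriting so that no factorial can be evaluated either.         *)
Ltac moment_field :=
  let f := fresh "f" in let hf := fresh "hf" in
  rewrite /moment; have := cos_coeff'1 R;
  move: (cos_coeff' 1) => f hf; rewrite ?hf; clear f hf;
  unfold stencilK, stencilM, stencilS, error_coef, error_coef_next;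
  rewrite ?weighted_sum_cons ?weighted_sum_nil; unfold multiplicity; by field.

Lemma moment_stencilK0 (R : realType) p : p \in [:: 2; 3; 4; 5]%N ->
  moment (stencilK R p) 0 = 0.
Proof. by rewrite !inE => /or4P[] /eqP->; moment_field. Qed.

Lemma moment_stencilM0 (R : realType) p : p \in [:: 2; 3; 4; 5]%N ->
  moment (stencilM R p) 0 = 1.
Proof. by rewrite !inE => /or4P[] /eqP->; moment_field. Qed.

Lemma moment_stencilKM (R : realType) p i : p \in [:: 2; 3; 4; 5]%N ->
  (i < p)%N -> moment (stencilK R p) i.+1 = moment (stencilM R p) i.
Proof.
rewrite !inE => /or4P[] /eqP->; do 5?[case: i => [|i]] => //  _;
moment_field.
Qed.

Lemma moment_stencilKMp (R : realType) p : p \in [:: 2; 3; 4; 5]%N ->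
  moment (stencilK R p) p.+1 = moment (stencilM R p) p + error_coef R p.
Proof. by rewrite !inE => /or4P[] /eqP->; moment_field. Qed.

(** The product with [moment (stencilM R p) 1] is the part of this difference that disappears when
    the symbol of [M] is factored out of the leading error term; only [error_coef_next] survives. *)
Lemma moment_stencilKMp1 (R : realType) p : p \in [:: 2; 3; 4; 5]%N ->
  moment (stencilK R p) p.+2 = moment (stencilM R p) p.+1 +
    error_coef R p * moment (stencilM R p) 1 + error_coef_next R p.
Proof. by rewrite !inE => /or4P[] /eqP->; moment_field. Qed.

(** The stencil [S] consists of signed central binomial coefficients; its symbol is
    [(2 sin (t/2))^(2p+2)]. *)
Lemma moment_stencilS0 (R : realType) p i : p \in [:: 2; 3; 4; 5]%N ->
  (i <= p)%N -> moment (stencilS R p) i = 0.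
Proof.
rewrite !inE => /or4P[] /eqP->; do 6?[case: i => [|i]] => //  _;
moment_field.
Qed.

Lemma moment_stencilSp (R : realType) p : p \in [:: 2; 3; 4; 5]%N ->
  moment (stencilS R p) p.+1 = 1.
Proof. by rewrite !inE => /or4P[] /eqP->; moment_field. Qed.

(** Both sides equal [-(p+1)/12]. *)
Lemma moment_stencilSp1 (R : realType) p : p \in [:: 2; 3; 4; 5]%N ->
  moment (stencilS R p) p.+2 = moment (stencilM R p) 1.
Proof. by rewrite !inE => /or4P[] /eqP->; moment_field. Qed.

(** * Finitely supported sums over the integers *)

Lemma fsum_int_window (V : nmodType) (F : int -> V) (lo : int) (n : nat) :
  (forall m : int, (m < lo) || (lo + n%:Z <= m) -> F m = 0) ->
  \sum_(m \in [set: int]) F m = \sum_(i < n) F (lo + i%:Z).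
Proof.
move=> F0.
have inj : injective (fun i : nat => lo + i%:Z) by move=> i j /addrI [].
rewrite (@fsbigE _ _ _ _ _ [seq lo + i%:Z | i <- iota 0 n]) //=.
- rewrite big_map -[X in iota _ X]subn0 -/(index_iota 0 n) big_mkord.
  by apply: eq_bigl => i; rewrite in_setT.
- by rewrite map_inj_uniq ?iota_uniq.
- move=> m _ mr; apply: F0; apply: contraNT mr; rewrite negb_or -leNgt -ltNge.
  move=> /andP[h1 h2]; apply/mapP; exists (absz (m - lo)); last by lia.
  by rewrite mem_iota; lia.
Qed.

(** The [D] arithmetic progressions through [c, ..., c + D - 1] partition the integers. *)
Lemma fsum_residues (V : nmodType) (f : int -> V) (D : nat) (c : int) :
  (0 < D)%N -> (exists B : nat, forall z, (B < absz z)%N -> f z = 0) ->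
  \sum_(i < D) \sum_(m \in [set: int]) f (c + i%:Z - D%:Z * m) =
  \sum_(z \in [set: int]) f z.
Proof.
(* [L] is so large that [|m| > L], and likewise a distance of at least [D L] from [c], leads out of
   the support of [f]. *)
move=> D0 [B fB]; pose L := (B + absz c + D)%N.
transitivity (\sum_(i < D) \sum_(m < L.*2.+1)
    f (c - (D * L)%:Z + (m * D + i)%N%:Z)).
  apply: eq_bigr => i _; have iD := ltn_ord i.
  rewrite (@reindex_fsbigT _ _ _ int int -%R) /=; last exact: (inv_bij opprK).
  rewrite (@fsum_int_window _ _ (- L%:Z) L.*2.+1).
    apply: eq_bigr => m _; congr f; rewrite PoszD !PoszM; ring.
  move=> m hm; apply: fB.
  have : (L < absz m)%N by clear -hm; clearbody L; lia.
  have : (absz m <= absz (D%:Z * m)%R)%N by rewrite abszM leq_pmull.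
  rewrite mulrN opprK /L; move: (D%:Z * m) => d; clear hm; lia.
rewrite exchange_big /= (@fsum_int_window _ _ (c - (D * L)%:Z) (L.*2.+1 * D)).
  rewrite -(big_mkord xpredT (fun i => f (c - (D * L)%:Z + i%:Z))).
  rewrite big_nat_mul big_mkord.
  apply: eq_bigr => m _.
  rewrite -{2}[(m * D)%N]add0n mulSn big_addn addnK big_mkord.
  by apply: eq_bigr => i _; rewrite addnC.
move=> z hz; apply: fB.
have : (D%:Z * L%:Z <= `|z - c|)%R by move: D0 hz; clear; clearbody L; nia.
rewrite /L; nia.
Qed.

Lemma sum_symmetric (V : zmodType) (G : int -> V) n :
  \sum_(i < n.*2.+1) G (- n%:Z + i%:Z) =
  \sum_(q < n.+1) if q == 0%N :> nat then G 0 else G q%:Z + G (- q%:Z).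
Proof.
elim: n => [|n IHn]; first by rewrite !big_ord1.
rewrite [RHS]big_ord_recr -IHn doubleS big_ord_recl big_ord_recr /= addr0.
rewrite (eq_bigr (fun i : 'I_n.*2.+1 => G (- n%:Z + i%:Z))); last first.
  by move=> i _; congr G; rewrite /bump /=; lia.
rewrite (_ : - n.+1%:Z + _ = n.+1%:Z); last by rewrite /bump /=; lia.
exact: etrans (addrC _ _) (esym (addrA _ _ _)).
Qed.

Lemma nth_absz_default (R : realType) (a : seq R) (d : int) :
  (size a <= absz d)%N -> a`_(absz d) = 0.
Proof. exact: nth_default. Qed.

(** * Toeplitz-plus-Hankel matrices as convolutions *)

(* The Toeplitz terms of column [j] collect the values of [U] at all integers *)
(* congruent to [j + 1] modulo [2 N], the Hankel terms those at the reflected *)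
(* integers. For even [p] these are all residues; for odd [p] only [0] and    *)
(* [N] are missing, where [U] vanishes.                                       *)
Lemma toeplitz_hankel_convolution (R : realType) (p N : nat) (a : seq R)
    (U : int -> R) (i : 'I_(ndof p N)) : (0 < N)%N ->
  (forall z m, U (z + (2 * N)%:Z * m) = U z) ->
  (forall z, U ((~~ odd p)%:Z - z) = - U z) ->
  \sum_j toeplitz_hankel p N a i j * U j.+1%:Z =
  \sum_(z \in [set: int]) a`_(absz (i.+1%:Z - z)%R) * U z.
Proof.
move=> N0 Uper Uasym.
pose f z := a`_(absz (i.+1%:Z - z)%R) * U z.
pose g c := \sum_(m \in [set: int]) f (c - (2 * N)%:Z * m).
have fB z : (i.+1 + size a < absz z)%N -> f z = 0.
  by move=> h; rewrite /f nth_absz_default ?mul0r //; lia.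
(* [U] is odd under [z -> r - z], a reflection about 0 for odd [p] and about 1/2 for even [p]; hence
   the Hankel index [k + l - r]. *)
pose r := (~~ odd p)%:Z.
have fgg (j : 'I_(ndof p N)) :
    toeplitz_hankel p N a i j * U j.+1%:Z = g j.+1%:Z + g (r - j.+1%:Z).
  (* One window for all sums: a shift by [2 N m] with [|m| > 2 W] moves both the column and its
     reflection out of reach of the stencil. *)
  pose W := (i.+1 + size a + absz (r - j.+1%:Z)%R + j.+1)%N.
  have aW z m : (absz z <= W)%N -> (2 * W < absz m)%N ->
      a`_(absz (i.+1%:Z - z + (2 * N)%:Z * m)%R) = 0.
    move=> hz hm; apply: nth_absz_default.
    have : (absz m <= absz ((2 * N)%:Z * m)%R)%N.
      by rewrite abszM leq_pmull ?muln_gt0.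
    have : (i.+1 + size a <= W)%N by rewrite /W; lia.
    by move: ((2 * N)%:Z * m) => d; clear -hm hz; clearbody W; lia.
  have fW z m : (absz z <= W)%N -> (2 * W < absz m)%N ->
      f (z - (2 * N)%:Z * m) = 0.
    by move=> hz hm; rewrite /f opprB [_ - z]addrC addrA aW ?mul0r.
  have mW m : (m < - (2 * W)%:Z) || (- (2 * W)%:Z + (2 * W).*2.+1%:Z <= m) ->
      (2 * W < absz m)%N by clearbody W; clear; lia.
  have W1 : (absz j.+1%:Z <= W)%N by rewrite /W /=; lia.
  have W2 : (absz (r - j.+1%:Z)%R <= W)%N by rewrite /W; lia.
  have step m : a`_(absz (i.+1%:Z - j.+1%:Z + 2%:Z * N%:Z * m)) * U j.+1%:Z =
      f (j.+1%:Z - (2 * N)%:Z * m).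
    rewrite /f -mulrN Uper; congr (a`_(absz _) * _); rewrite PoszM; ring.
  (* Antisymmetry absorbs the minus sign of the Hankel term by moving [U] to the reflected
     column. *)
  have step2 m : - a`_(absz ((if odd p then i.+1%:Z + j.+1%:Z
        else i.+1%:Z + j.+1%:Z - 1) + 2%:Z * N%:Z * m)) * U j.+1%:Z =
      f (r - j.+1%:Z - (2 * N)%:Z * m).
    rewrite /f -mulrN Uper Uasym mulNr -[LHS]mulrN; congr (a`_(absz _) * _).
    by rewrite /r PoszM; case: odd => /=; ring.
  rewrite mxE /g !(@fsum_int_window _ _ (- (2 * W)%:Z) (2 * W).*2.+1).
  - rewrite -big_split /= mulr_suml; apply: eq_bigr => m _.
    by rewrite mulrDl step step2.
  - by move=> m /mW hm; exact: fW.
  - by move=> m /mW hm; exact: fW.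
  - move=> m /mW hm.
    have := aW _ _ W1 hm; have := aW _ _ W2 hm.
    rewrite PoszM => h1 ->; rewrite sub0r; apply/eqP; rewrite oppr_eq0.
    apply/eqP; apply: etrans h1; congr (a`_(absz (_ + _))).
    by rewrite /r; case: odd => /=; ring.
rewrite (eq_bigr _ (fun j _ => fgg j)) big_split /=.
(* The residues modulo [2 N] are represented by [-(N-1), ..., N]: the columns form the upper part,
   their reflections the lower one. *)
rewrite -(@fsum_residues _ f (2 * N) (- N.-1%:Z)) ?muln_gt0 //; last first.
  by eexists; exact: fB.
rewrite -[LHS]/(\sum_(j < ndof p N) g j.+1%:Z +
  \sum_(j < ndof p N) g (r - j.+1%:Z)).
rewrite -[RHS]/(\sum_(l < 2 * N) g (- N.-1%:Z + l%:Z)).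
have g0 c : U c = 0 -> g c = 0.
  move=> Uc; rewrite /g; apply: fsbig1 => m _.
  by rewrite /f -mulrN Uper Uc mulr0.
have self_opp0 (x : R) : x = - x -> x = 0 by lra.
clear fgg; move: g g0 => {}g g0; move: Uasym; rewrite {}/r /ndof {i f fB}.
case: N N0 Uper => // M _ Uper; rewrite [M.+1.-1]/=.
case: odd => /= Uasym.
- have U0 : U 0 = 0 by apply: self_opp0; rewrite -Uasym subr0.
  (* [N] and [-N] differ by one period. *)
  have UN : U M.+1%:Z = 0.
    apply: self_opp0; rewrite -Uasym sub0r -[RHS](Uper _ 1); congr U; lia.
  rewrite (_ : 2 * M.+1 = (M.+1 + M).+1)%N; last by lia.
  rewrite big_ord_recr big_split_ord big_ord_recr /=.
  rewrite (_ : - M%:Z + M%:Z = 0) ?addNr // (g0 _ U0) addr0.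
  rewrite (_ : - M%:Z + (M.+1 + M)%N%:Z = M.+1%:Z); last by lia.
  rewrite (g0 _ UN) addr0 [LHS]addrC; congr (_ + _).
    rewrite (reindex_inj rev_ord_inj); apply: eq_bigr => j _ /=; congr g.
    by have := ltn_ord j; lia.
  by apply: eq_bigr => j _ /=; congr g; lia.
- rewrite mul2n -addnn big_split_ord /= [LHS]addrC; congr (_ + _).
    rewrite (reindex_inj rev_ord_inj); apply: eq_bigr => j _ /=; congr g.
    by have := ltn_ord j; lia.
  by apply: eq_bigr => j _ /=; congr g; lia.
Qed.

(** * Bloch waves as common eigenvectors *)

Definition wave (R : realType) (p N j : nat) (z : int) : R :=
  let t := omega R j * meshsize R N in
  sin (t * (z%:~R - (~~ odd p)%:R / 2%:R)).

Lemma blochE (R : realType) (p N j : nat) (i : 'I_(ndof p N)) :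
  bloch R p N j i 0 = wave R p N j i.+1%:Z.
Proof.
by rewrite mxE /wave /=; case: odd => /=; congr sin; rewrite -?pmulrn; ring.
Qed.

Lemma sinDnpi2 (R : realType) (x : R) (n : nat) :
  sin (x + pi *+ 2 *+ n) = sin x.
Proof.
by elim: n => [|n IHn]; rewrite ?addr0 // mulrSr addrA sinD2pi.
Qed.

(** Since [omega_j h N = j pi], a shift by [2 N] adds [2 j pi] to the argument of the sine. *)
Lemma wave_periodic (R : realType) (p N j : nat) (z m : int) : (0 < N)%N ->
  wave R p N j (z + (2 * N)%:Z * m) = wave R p N j z.
Proof.
move=> N0; rewrite /wave.
set t := omega R j * _; set c := _ / 2%:R.
have tN : t * N%:R = j%:R * pi.
  by rewrite /t /omega /meshsize mulfVK // pnatr_eq0 -lt0n.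
have E (n : nat) (y : R) :
    sin (t * (y + (2 * N)%N%:R * n%:R - c)) = sin (t * (y - c)).
  rewrite -(sinDnpi2 (t * (y - c)) (j * n)); congr sin.
  transitivity (t * (y - c) + 2%:R * n%:R * (t * N%:R)); first by ring.
  by rewrite tN -(mulr_natr _ (j * n)) -(mulr_natr pi 2) natrM; ring.
case: (intP m) => [|n|n]; rewrite ?mulr0 ?addr0 //.
  by rewrite intrD intrM -!pmulrn E.
rewrite -(E n.+1) intrD intrM intrN; congr (sin (t * (_ - c))).
by rewrite -!pmulrn; ring.
Qed.

Lemma wave_antisymmetric (R : realType) (p N j : nat) (z : int) :
  wave R p N j ((~~ odd p)%:Z - z) = - wave R p N j z.
Proof.
rewrite /wave -sinN intrB; congr sin.
by case: odd => /=; field.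
Qed.

(** Opposite offsets combine by [sin (x + y) + sin (x - y) = 2 sin x cos y]. *)
Lemma sum_wave (R : realType) (p N j : nat) (a : seq R) (k : int) :
  \sum_(z \in [set: int]) a`_(absz (k - z)%R) * wave R p N j z =
  symbol a (omega R j * meshsize R N) * wave R p N j k.
Proof.
set t := omega R j * _.
rewrite (@fsum_int_window _ _ (k - (size a)%:Z) (size a).*2.+1); last first.
  by move=> z hz; rewrite nth_absz_default ?mul0r //; lia.
pose G d := a`_(absz d) * wave R p N j (k + d).
transitivity (\sum_(i < (size a).*2.+1) G (- (size a)%:Z + i%:Z)).
  by apply: eq_bigr => i _; rewrite /G addrA -abszN opprB;
    congr (a`_(absz _) * _); ring.
(* The outermost offset [size a] lies beyond the stencil and contributes 0; an empty stencil makes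
   it the offset 0. *)
rewrite sum_symmetric big_ord_recr /= -[RHS]addr0; congr (_ + _); last first.
  case: eqP => [sa|_]; last by rewrite /G abszN !nth_absz_default ?mul0r ?addr0.
  by rewrite /G nth_absz_default ?mul0r // sa.
rewrite /symbol weighted_sum.unlock mulr_suml; apply: eq_bigr => q _.
rewrite add0n /G; case: (nat_of_ord q) => [|n].
  by rewrite /= mul0r cos0 addr0; ring.
rewrite abszN /= /wave -/t; set c := _ / 2%:R.
rewrite !intrD intrN -!pmulrn.
have -> : t * (k%:~R + n.+1%:R - c) = t * (k%:~R - c) + n.+1%:R * t by ring.
have -> : t * (k%:~R - n.+1%:R - c) = t * (k%:~R - c) - n.+1%:R * t by ring.
rewrite sinD sinB; ring.
Qed.

Lemma toeplitz_hankel_bloch (R : realType) (p N j : nat) (a : seq R) :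
  (0 < N)%N ->
  toeplitz_hankel p N a *m bloch R p N j =
  symbol a (omega R j * meshsize R N) *: bloch R p N j.
Proof.
move=> N0; apply/colP => i; rewrite mxE [RHS]mxE blochE -sum_wave.
rewrite -toeplitz_hankel_convolution //.
- by apply: eq_bigr => l _; rewrite blochE.
- by move=> z m; exact: wave_periodic.
- by move=> z; exact: wave_antisymmetric.
Qed.

(** Both matrices act on the nonzero wave as scalars, so the eigenvalue is unique and [xget] returns
    it; [N^2] is the quotient of the scalings [h^-1] and [h]. *)
Lemma softIGA_eigenvalueE (R : realType) (p : nat) (eta : R) (N j : nat) :
  let t := omega R j * meshsize R N in
  (0 < N)%N -> bloch R p N j != 0 -> symbol (stencilM R p) t != 0 ->
  softIGA_eigenvalue p eta N j =
  N%:R ^+ 2 * (symbol (stencilK R p) t - eta * symbol (stencilS R p) t) /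
  symbol (stencilM R p) t.
Proof.
move=> t N0 U0 M0; have NR : N%:R != 0 :> R by rewrite pnatr_eq0 -lt0n.
set lam := RHS.
have AE : (stiffness R p N - eta *: softness R p N) *m bloch R p N j =
    (N%:R * (symbol (stencilK R p) t - eta * symbol (stencilS R p) t)) *:
      bloch R p N j.
  rewrite mulmxBl -!scalemxAl !toeplitz_hankel_bloch // !scalerA -scalerBl.
  by congr (_ *: _); rewrite /meshsize invrK -/t; ring.
have BE : mass R p N *m bloch R p N j =
    (N%:R^-1 * symbol (stencilM R p) t) *: bloch R p N j.
  by rewrite -scalemxAl toeplitz_hankel_bloch // scalerA.
apply: xget_unique => [|mu [_]].
  split=> //; rewrite AE BE scalerA; congr (_ *: _).
  by rewrite /lam; field; rewrite NR M0.
rewrite AE BE scalerA => /eqP; rewrite -subr_eq0 -scalerBl scaler_eq0.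
rewrite (negPf U0) orbF subr_eq0 => /eqP h; apply/esym.
have -> : mu = N%:R * (mu * (N%:R^-1 * symbol (stencilM R p) t)) /
    symbol (stencilM R p) t by field; rewrite NR M0.
by rewrite -h /lam; field; rewrite M0.
Qed.

Lemma bloch_neq0 (R : realType) (p N j : nat) :
  mode_index p N j -> omega R j * meshsize R N < 1 -> bloch R p N j != 0.
Proof.
case/andP=> j1 jn; set t := omega R j * _ => t1.
have n0 : (0 < ndof p N)%N by exact: leq_trans jn.
have N0 : (0 < N)%N by move: n0; rewrite /ndof; case: odd; case: (N).
have t0 : 0 < t.
  by rewrite /t /omega /meshsize divr_gt0 ?mulr_gt0 ?pi_gt0 ?ltr0n.
(* The first entry is [sin t] or [sin (t/2)], with argument in [(0, pi)]. *)
apply/eqP => /colP /(_ (Ordinal n0)); rewrite blochE mxE /wave -/t => /eqP.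
apply/negP; rewrite gt_eqF //; apply: sin_gt0_pi.
have := @pi_ge2 R; case: odd => /= hpi; apply/andP; split; nra.
Qed.

(** * Expansion of the quotient of symbols *)

Lemma symbol_residual (R : realType) (p : nat) (eta t : R) :
  p \in [:: 2; 3; 4; 5]%N ->
  let k := moment (stencilK R p) in let s := moment (stencilS R p) in
  let m := moment (stencilM R p) in
  \sum_(i < p.+3) k i * t ^+ i.*2 - eta * \sum_(i < p.+3) s i * t ^+ i.*2 =
  t ^+ 2 * \sum_(i < p.+2) m i * t ^+ i.*2 +
  (error_coef R p - eta) * t ^+ p.+1.*2 * (1 + m 1%N * t ^+ 2) +
  error_coef_next R p * t ^+ p.+2.*2.
Proof.
move=> hp k s m.
have hS : \sum_(i < p.+3) s i * t ^+ i.*2 = t ^+ p.+1.*2 * (1 + m 1%N * t ^+ 2).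
  rewrite 2!big_ord_recr big1 /=.
    rewrite /s moment_stencilSp // moment_stencilSp1 // -/m !doubleS !exprS.
    by ring.
  by move=> i _; rewrite /s moment_stencilS0 ?mul0r // -ltnS.
rewrite hS [in LHS]big_ord_recl 2![in LHS]big_ord_recr
  2![in RHS]big_ord_recr /=.
rewrite /bump /= !add1n /k moment_stencilK0 // moment_stencilKMp //.
rewrite moment_stencilKMp1 // -/m.
rewrite (eq_bigr (fun i : 'I_p => t ^+ 2 * (m i * t ^+ i.*2))); last first.
  move=> i _; rewrite add1n moment_stencilKM ?ltn_ord // -/m.
  by rewrite doubleS !exprS; ring.
rewrite -mulr_sumr !doubleS !exprS.
move: (\sum_(i < p) _) (t ^+ p.*2) (m p) (m p.+1) (m 1%N) => X Y m1 m2 m3.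
move: (error_coef R p) (error_coef_next R p) => c d; ring.
Qed.

(** By [symbol_residual], with [A = error_coef R p - eta] and [d = error_coef_next R p], the
    numerator is [t^2 M (1 + A t^(2p) + d t^(2p+2))] up to [O(t^(2p+6))]; then divide by [t^2 M]. *)
Lemma softIGA_dispersion (R : realType) (p : nat) (eta : R) :
  p \in [:: 2; 3; 4; 5]%N ->
  exists C delta : R, [/\ 0 < C, 0 < delta, delta <= 1 &
    forall t : R, 0 < t -> t < delta ->
    0 < symbol (stencilM R p) t /\
    `| ((symbol (stencilK R p) t - eta * symbol (stencilS R p) t) /
        symbol (stencilM R p) t / t ^+ 2 - 1)
       - ((error_coef R p - eta) * t ^+ (2 * p)
          + error_coef_next R p * t ^+ (2 * p + 2)) |
      <= C * t ^+ (2 * p + 4)].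
Proof.
move=> hp.
(* The truncation orders are such that each remainder, times the power of [t] in front of it in [D]
   below, is of order [t^(2p+6)]. *)
have [CK CK0 tK] := symbol_taylor (stencilK R p) p.+3.
have [CS CS0 tS] := symbol_taylor (stencilS R p) p.+3.
have [CM CM0 tM] := symbol_taylor (stencilM R p) p.+2.
have [C1 C10 tM1] := symbol_taylor (stencilM R p) 1.
have [C2 C20 tM2] := symbol_taylor (stencilM R p) 2.
have residual := fun t => symbol_residual eta t hp.
move: (moment_stencilM0 R hp) residual.
move: (error_coef R p - eta) (error_coef_next R p) => A d.
move: (stencilK R p) (stencilS R p) (stencilM R p) tK tS tM tM1 tM2.
move=> aK aS aM tK tS tM tM1 tM2 m0 residual.
pose C := CK + `|eta| * CS + CM + `|A| * C2 + `|d| * C1.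
have C0 : 0 <= C by rewrite /C !addr_ge0 // mulr_ge0.
(* For [t < 1/B] all Taylor bounds apply, and [2 C1 t < 1] keeps [M] at least 1/2. *)
pose B : R := 1 + (size aK)%:R + (size aS)%:R + (size aM)%:R + 2%:R * C1.
have [kn sn mn] : [/\ (0 : R) <= (size aK)%:R, (0 : R) <= (size aS)%:R &
  (0 : R) <= (size aM)%:R] by [].
have B1 : 1 <= B by rewrite /B; lra.
have B0 : 0 < B by lra.
(* The factor 2 compensates [M >= 1/2]; the added 1 makes the constant positive. *)
exists (2%:R * C + 1), B^-1; split.
- lra.
- by rewrite invr_gt0.
- by rewrite invf_le1.
move=> t t0 tB.
have tB1 : t * B < 1 by rewrite -ltr_pdivlMr // div1r.
have t1 : t <= 1 by nra.
have tN (n : nat) : t * B <= 1 -> n%:R <= B -> t * n%:R <= 1.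
  by move=> h1 h2; apply: le_trans h1; rewrite ler_wpM2l // ltW.
have hK : t * (size aK)%:R <= 1 by apply: tN; [exact: ltW | rewrite /B; lra].
have hS : t * (size aS)%:R <= 1 by apply: tN; [exact: ltW | rewrite /B; lra].
have hM : t * (size aM)%:R <= 1 by apply: tN; [exact: ltW | rewrite /B; lra].
have {}tK := tK t (ltW t0) hK; have {}tS := tS t (ltW t0) hS.
have {}tM := tM t (ltW t0) hM; have {}tM1 := tM1 t (ltW t0) hM.
have {}tM2 := tM2 t (ltW t0) hM.
rewrite big_ord1 m0 expr0 mulr1 in tM1.
rewrite !big_ord_recl big_ord0 /= m0 expr0 mulr1 addr0 in tM2.
have {residual} /= := residual t.
set PK := \sum_(i < p.+3) moment aK i * _ in tK *.
set PS := \sum_(i < p.+3) moment aS i * _ in tS *.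
set PM := \sum_(i < p.+2) moment aM i * _ in tM *.
move: PK PS PM tK tS tM => PK PS PM tK tS tM residual.
rewrite /bump /= in tM2.
move: (symbol aK t) (symbol aS t) (symbol aM t) (moment aM 1) => K S M m1 in
  tK tS tM tM1 tM2 residual *.
rewrite exprD [t ^+ (2 * p + 4)]exprD mul2n.
move: tK tS tM tM1 tM2 residual; rewrite !doubleS double0.
have tX n : t ^+ n.+2 = t * t * t ^+ n by rewrite -mulrA -!exprS.
rewrite !tX expr0 !mulr1; set T := t * t; set X := t ^+ p.*2.
have T0 : 0 < T by rewrite /T mulr_gt0.
have X0 : 0 < X by rewrite exprn_gt0.
move=> tK tS tM tM1 tM2 residual.
have M2 : 1 / 2%:R <= M.
  have : C1 * T <= 1 / 2%:R by rewrite /T; rewrite /B in tB1; nra.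
  by move: tM1; rewrite ler_norml => /andP[]; lra.
split; first by lra.
(* [D] collects the Taylor remainders; [residual] cancels the polynomial parts. *)
clearbody T X; pose D := (K - PK) - eta * (S - PS) - T * (M - PM)
  - A * X * T * (M - (1 + m1 * T)) - d * X * T * T * (M - 1).
have -> : (K - eta * S) / M / T - 1 - (A * X + d * (X * T)) = D / (T * M).
  have -> : D = K - eta * S - T * M * (1 + A * X + d * X * T).
    transitivity (K - eta * S - (PK - eta * PS) - T * (M - PM)
      - A * X * T * (M - (1 + m1 * T)) - d * X * T * T * (M - 1)).
      by rewrite /D; ring.
    by rewrite residual; ring.
  by field; rewrite !gt_eqF //; lra.
have TM0 : 0 < T * M by rewrite mulr_gt0 //; lra.
rewrite normrM normfV (ger0_norm (ltW TM0)) ler_pdivrMr //.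
pose Y := T * (T * (T * X)).
have Y0 : 0 <= Y by rewrite /Y !mulr_ge0 // ltW.
have DC : `|D| <= C * Y.
  have -> : C * Y = CK * Y + `|eta| * (CS * Y) + T * (CM * (T * (T * X)))
      + `|A| * X * T * (C2 * (T * T)) + `|d| * X * T * T * (C1 * T).
    by rewrite /C /Y; ring.
  rewrite /D; do 4!(apply: le_trans (ler_normB _ _) _; apply: lerD; last by
    rewrite !normrM ?(gtr0_norm T0) ?(gtr0_norm X0) ler_wpM2l
      ?mulr_ge0 ?(ltW T0) ?(ltW X0)).
  exact: tK.
apply: le_trans DC _; rewrite (_ : _ * (T * M) = (2%:R * C + 1) * M * Y);
  last by rewrite /Y; ring.
by rewrite ler_wpM2r //; nra.
Qed.

(** * Relative eigenvalue errors *)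

Lemma mode_index_gt0 (p N j : nat) :
  mode_index p N j -> (0 < N)%N /\ (0 < j)%N.
Proof.
case/andP=> j1 jn; split=> //; move: (leq_trans j1 jn).
by rewrite /ndof; case: odd; case: (N).
Qed.

(** As [omega_j = t N], the factor [N^2] cancels and the error depends on [N] and [j] through [t]
    only, so the constants are uniform in both. *)
Lemma rel_error_expansion (R : realType) (p : nat) (eta : R) :
  p \in [:: 2; 3; 4; 5]%N ->
  exists C delta : R, [/\ 0 < C, 0 < delta &
    forall N j : nat, mode_index p N j ->
      let t := omega R j * meshsize R N in
      t < delta ->
      `| rel_error p eta N j
         - ((error_coef R p - eta) * t ^+ (2 * p)
            + error_coef_next R p * t ^+ (2 * p + 2)) |
        <= C * t ^+ (2 * p + 4)].
Proof.
move=> /(softIGA_dispersion eta) [C [delta [C0 d0 d1 h]]].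
exists C, delta; split=> // N j mj t td.
have [N0 j0] := mode_index_gt0 mj.
have w0 : 0 < omega R j by rewrite mulr_gt0 ?pi_gt0 ?ltr0n.
have t0 : 0 < t by rewrite /t /meshsize divr_gt0 // ltr0n.
have [M0] := h t t0 td; apply: le_trans.
rewrite /rel_error (softIGA_eigenvalueE eta N0) -/t.
- rewrite le_eqVlt; apply/orP; left; apply/eqP; congr (`|_ - _|).
  have NR : N%:R != 0 :> R by rewrite pnatr_eq0 -lt0n.
  rewrite /lambda_exact (_ : omega R j = t * N%:R); last first.
    by rewrite /t /meshsize mulfVK.
  by field; rewrite NR (gt_eqF M0) (gt_eqF t0).
- by apply: bloch_neq0 => //; exact: lt_le_trans d1.
- by rewrite gt_eqF.
Qed.

(* Only finitely many meshes have [omega j * h >= delta], so a bound in the   *)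
(* asymptotic regime extends to all meshes at the price of a larger constant. *)
Lemma bound_all_meshes (R : realType) (p : nat) (eta : R) (k : nat)
    (C delta : R) (j : nat) : 0 < C -> 0 < delta ->
  (forall N, mode_index p N j -> omega R j * meshsize R N < delta ->
    `|rel_error p eta N j| <= C * (omega R j * meshsize R N) ^+ k) ->
  exists C' : R, 0 < C' /\
    forall N : nat, mode_index p N j ->
      `| softIGA_eigenvalue p eta N j - lambda_exact R j | / lambda_exact R j
        <= C' * meshsize R N ^+ k.
Proof.
move=> C0 d0 h.
(* [N >= N1] forces [omega_j h < delta]. *)
pose N1 := Num.bound (omega R j / delta).
(* The least constant that serves the mesh [N]. *)
pose E N := `|rel_error p eta N j| * N%:R ^+ k.
have w0 : 0 <= omega R j by rewrite mulr_ge0 // pi_ge0.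
have E0 N : 0 <= E N by rewrite mulr_ge0 // exprn_ge0.
have S0 : 0 <= \sum_(i < N1) E i by exact: sumr_ge0.
exists (C * omega R j ^+ k + \sum_(i < N1) E i + 1); split.
  by rewrite ltr_wpDl // addr_ge0 // mulr_ge0 ?exprn_ge0 // ltW.
move=> N mj; have [N0 j0] := mode_index_gt0 mj.
have NR : 0 < N%:R :> R by rewrite ltr0n.
have l0 : 0 <= lambda_exact R j by rewrite /lambda_exact exprn_ge0.
rewrite -[X in _ / X](ger0_norm l0) -normf_div -/(rel_error p eta N j).
rewrite /meshsize exprVn ler_pdivlMr ?exprn_gt0 // -/(E N).
have [NN|NN] := ltnP N N1.
  rewrite (bigD1 (Ordinal NN)) //=.
  have : 0 <= \sum_(i < N1 | i != Ordinal NN) E i by exact: sumr_ge0.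
  have : 0 <= C * omega R j ^+ k by rewrite mulr_ge0 ?exprn_ge0 // ltW.
  lra.
have td : omega R j * meshsize R N < delta.
  rewrite /meshsize ltr_pdivrMr // mulrC -ltr_pdivrMr //.
  apply: lt_le_trans (archi_boundP _) _; first by rewrite divr_ge0 // ltW.
  by rewrite ler_nat.
have EN : E N <= C * omega R j ^+ k.
  apply: le_trans (ler_wpM2r _ (h N mj td)) _; first by rewrite exprn_ge0.
  by rewrite /meshsize -mulrA -exprMn mulfVK // gt_eqF.
lra.
Qed.

Theorem mainTheorem7 (R : realType) (p : nat) (eta : R)
    (hp : p \in [:: 2; 3; 4; 5]%N) (heta : 0 <= eta) :
  [/\ (exists C delta : R, [/\ 0 < C, 0 < delta &
        forall N j : nat, mode_index p N j ->
          let t := omega R j * meshsize R N in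
          t < delta ->
          `| rel_error p eta N j
             - ((error_coef R p - eta) * t ^+ (2 * p)
                + error_coef_next R p * t ^+ (2 * p + 2)) |
            <= C * t ^+ (2 * p + 4)]),
      (forall j : nat, exists C : R, 0 < C /\
        forall N : nat, mode_index p N j ->
          `| softIGA_eigenvalue p eta N j - lambda_exact R j | / lambda_exact R j
            <= C * meshsize R N ^+ (2 * p)) &
      (eta = error_coef R p ->
        forall j : nat, exists C : R, 0 < C /\
        forall N : nat, mode_index p N j ->
          `| softIGA_eigenvalue p eta N j - lambda_exact R j | / lambda_exact R j
            <= C * meshsize R N ^+ (2 * p + 2))].
Proof.
have H := rel_error_expansion eta hp; split=> //.
  case: H => C [delta [C0 d0 h]] j.
  set A := error_coef R p - eta in h.
  set d := error_coef_next R p in h; clearbody A d.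
  (* With [t < 1] the higher powers of [t] are absorbed into [t^(2p)]. *)
  apply: (@bound_all_meshes R p eta _ (`|A| + `|d| + C) (Num.min delta 1)).
  - by rewrite ltr_wpDl // addr_ge0.
  - by rewrite lt_min d0 ltr01.
  - move=> N mj; rewrite lt_min => /andP[td t1].
    have {h} := h N j mj td; set t := omega R j * _ in t1 *.
    set e := rel_error _ _ _ _ => h.
    have t0 : 0 <= t by rewrite /t !mulr_ge0 ?pi_ge0 // invr_ge0.
    have X0 : 0 <= t ^+ (2 * p) by rewrite exprn_ge0.
    rewrite -(subrK (A * t ^+ (2 * p) + d * t ^+ (2 * p + 2)) e).
    apply: le_trans (ler_normD _ _) _; rewrite [leLHS]addrC !mulrDl.
    apply: lerD; last first.
      apply: le_trans h _; rewrite exprD mulrA ler_piMr ?mulr_ge0 ?(ltW C0) //.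
      by rewrite exprn_ile1 // ltW.
    apply: le_trans (ler_normD _ _) _; apply: lerD.
      by rewrite normrM (ger0_norm X0).
    rewrite normrM ler_wpM2l // exprD normrM (ger0_norm X0) ler_piMr //.
    by rewrite ger0_norm ?exprn_ge0 // exprn_ile1 // ltW.
move=> eta_eq j; case: H => C [delta [C0 d0 h]].
set d := error_coef_next R p in h.
apply: (@bound_all_meshes R p eta _ (`|d| + C) (Num.min delta 1)).
- by rewrite ltr_wpDl.
- by rewrite lt_min d0 ltr01.
- move=> N mj; rewrite lt_min => /andP[td t1].
  have {h} := h N j mj td; set t := omega R j * _ in t1 *.
  (* The choice of [eta] removes the term of order [t^(2p)]. *)
  set e := rel_error _ _ _ _; rewrite -eta_eq subrr mul0r add0r => h.
  have t0 : 0 <= t by rewrite /t !mulr_ge0 ?pi_ge0 // invr_ge0.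
  have X0 : 0 <= t ^+ (2 * p + 2) by rewrite exprn_ge0.
  rewrite -(subrK (d * t ^+ (2 * p + 2)) e).
  apply: le_trans (ler_normD _ _) _; rewrite [leLHS]addrC mulrDl; apply: lerD.
    by rewrite normrM (ger0_norm X0).
  apply: le_trans h _; rewrite (_ : 2 * p + 4 = 2 * p + 2 + 2)%N; last by lia.
  rewrite [in leLHS]exprD mulrA ler_piMr ?mulr_ge0 ?(ltW C0) //.
  by rewrite exprn_ile1 // ltW.
Qed.
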